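(* Let $(G,\cdot)$ be an arbitrary group and consider the almost trivial skew brace $(G,\cdot,\cdot^{\mathrm{op}})$. Then its $\star$-product is associative if and only if $\gamma_3(G)=1$, i.e. $G$ has nilpotency class at most $2$.
   Context: A skew brace is a triple $(A,\cdot,\bullet)$ where $(A,\cdot)$ and $(A,\bullet)$ are groups with the same identity such that $a\bullet(b\cdot c)=(a\bullet b)\cdot a^{-1}\cdot(a\bullet c)$ for all $a,b,c\in A$, where $a^{-1}$ denotes the inverse of $a$ in $(A,\cdot)$. The $\star$-product is $a\star b:=a^{-1}\cdot(a\bullet b)\cdot b^{-1}$. The almost trivial skew brace on a group $(G,\cdot)$ is $(G,\cdot,\cdot^{\mathrm{op}})$, i.e. $a\bullet b=a\cdot^{\mathrm{op}}b:=b\cdot a$; hence $a\star b=a^{-1}ba b^{-1}=[a,b^{-1}]$ with $[x,y]=x^{-1}y^{-1}xy$. The lower central series is $\gamma_1(G)=G$, $\gamma_{n+1}(G)=[\gamma_n(G),G]$. *)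

(* Defs.v *)
From HB Require Import structures.
From mathcomp Require Import all_boot.
From mathcomp Require Import boolp classical_sets.

Set Implicit Arguments.
Unset Strict Implicit.
Unset Printing Implicit Defensive.

Local Open Scope classical_set_scope.
Local Open Scope group_scope.

(* The canonical [groupType] structure of the carrier is the group (A, .);
   the group (A, o) is given by explicit operations, its identity being the
   identity 1 of (A, .). *)
Record skew_brace := SkewBrace {
  sb_group :> groupType;
  circ : sb_group -> sb_group -> sb_group;
  circV : sb_group -> sb_group;
  circA : associative circ;
  circ1l : left_id 1 circ;
  circ1r : right_id 1 circ;
  circVl : left_inverse 1 circV circ;
  circVr : right_inverse 1 circV circ;
  circ_compat : forall a b c : sb_group,
    circ a (b * c) = circ a b * a^-1 * circ a c
}.

Definition star (A : skew_brace) (a b : A) : A := a^-1 * circ a b * b^-1.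
Arguments star : clear implicits.

Section AlmostTrivial.
Variable G : groupType.

Definition mul_op (a b : G) : G := b * a.

Lemma mul_opA : associative mul_op.
Proof. by move=> a b c; rewrite /mul_op mulgA. Qed.

Lemma mul_op1l : left_id 1 mul_op.
Proof. exact: mulg1. Qed.

Lemma mul_op1r : right_id 1 mul_op.
Proof. exact: mul1g. Qed.

Lemma mul_opVl : left_inverse 1 (@inv G) mul_op.
Proof. exact: mulgV. Qed.

Lemma mul_opVr : right_inverse 1 (@inv G) mul_op.
Proof. exact: mulVg. Qed.

Lemma mul_op_compat a b c :
  mul_op a (b * c) = mul_op a b * a^-1 * mul_op a c.
Proof. by rewrite /mul_op mulgK mulgA. Qed.

Definition almost_trivial : skew_brace :=
  SkewBrace mul_opA mul_op1l mul_op1r mul_opVl mul_opVr mul_op_compat.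

Lemma star_almost_trivialE (a b : G) :
  star almost_trivial a b = [~ a, b^-1].
Proof. by rewrite /star /= /mul_op /commg /conjg invgK !mulgA. Qed.

End AlmostTrivial.

Section LowerCentral.
Variable G : groupType.

(* [smallest C X] is the intersection of all sets containing X and
   satisfying C. *)
Definition generated_subgroup (X : set G) : set G :=
  smallest (fun H : set G => group_closed [in H]) X.

Definition commutator_subgroup (H K : set G) : set G :=
  generated_subgroup [set [~ x, y] | x in H & y in K].

(* Indexed from 1; the value at 0 is a junk value, also G. *)
Definition lower_central (n : nat) : set G :=
  iter n.-1 (fun H => commutator_subgroup H setT) setT.

End LowerCentral.
Arguments lower_central : clear implicits.

(* Main.v *)
Require Import Defs.
From HB Require Import structures.
From mathcomp Require Import all_boot.
From mathcomp Require Import boolp classical_sets.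

(** The operation under study is [a * b = [~ a, b^-1]]. In class at most 2 every
commutator is central, so both sides of the associativity law are 1.

Conversely, let the law hold. As [b * b = 1], the instance
[a * (b * b) = (a * b) * b] says that [[~ a, b]] commutes with [b] for all
[a] and [b] (the 2-Engel condition, [commute_commgr]). Signs can then be moved
out of commutators, and the law takes the form
  [[~ x, y, z] = [~ y, z, x]^-1]   ([commg3_rot]).
Rotating, the triple commutator is, up to inversion, one whose last entry is any
prescribed one of [x], [y], [z]; so it commutes with all three, and the
conjugations disappear from the Hall-Witt identity. What remains is
  [[~ y, z, x]^-1 * [~ z, x, y]^-1 * [~ x, y, z]^-1 = 1],
where by rotation the first two factors cancel, so that the last one is
trivial ([commg3_eq1]). *)

Local Open Scope classical_set_scope.
Local Open Scope group_scope.

(** * Commutator identities in arbitrary groups *)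

Section CommutatorIdentities.
Variable G : groupType.
Implicit Types x y z : G.

Lemma commgVr x y : commute [~ x, y] y -> [~ x, y^-1] = [~ x, y]^-1.
Proof.
have -> : [~ x, y^-1] = [~ x, y]^-1 ^ y^-1.
  by rewrite /commg /conjg !invgM !invgK !mulgA mulgV mul1g.
move=> cxyy; apply/conjg_fixP/commgP/commuteV.
exact/commute_sym/commuteV/commute_sym.
Qed.

Lemma commgVl x y : commute [~ x, y] x -> [~ x^-1, y] = [~ x, y]^-1.
Proof.
move=> cxyx; have cyxx : commute [~ y, x] x.
  by rewrite -invgR; apply/commute_sym/commuteV/commute_sym.
by rewrite -[LHS]invgR commgVr // invgR.
Qed.

Lemma Hall_Witt x y z :
  [~ x, y^-1, z] ^ y * [~ y, z^-1, x] ^ z * [~ z, x^-1, y] ^ x = 1.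
Proof.
rewrite /commg /conjg !invgM !invgK !mulgA.
by do !rewrite ?mulgK ?mulgVK ?mulVg ?mulgV ?mul1g.
Qed.

End CommutatorIdentities.

(** * Associativity forces triple commutators to vanish *)

Section AssociativeStar.
Variable G : groupType.
Hypothesis starA : associative (star (almost_trivial G)).
Implicit Types x y z : G.

Let commA x y z : [~ x, [~ y, z^-1]^-1] = [~ x, y^-1, z^-1].
Proof. by have := starA x y z; rewrite !star_almost_trivialE. Qed.

(** The 2-Engel condition. As the star-product of [y^-1] with itself is 1,
associativity at [x], [y^-1], [y^-1] reads [1 = [~ x, y, y]]. *)
Lemma commute_commgr x y : commute [~ x, y] y.
Proof.
apply/commgP/eqP.
by have := commA x y^-1 y^-1; rewrite !invgK invgR commgVg commg1.
Qed.

Lemma commute_commgl x y : commute [~ x, y] x.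
Proof. by rewrite -invgR; apply/commute_sym/commuteV/commute_sym/commute_commgr. Qed.

Let commVr x y : [~ x, y^-1] = [~ x, y]^-1.
Proof. exact/commgVr/commute_commgr. Qed.

Let commVl x y : [~ x^-1, y] = [~ x, y]^-1.
Proof. exact/commgVl/commute_commgl. Qed.

(** Associativity itself, which equates [[~ x, [~ y, z]]] with [[~ x, y, z]]
once signs can be moved out of commutators. *)
Lemma commg3_rot x y z : [~ x, y, z] = [~ y, z, x]^-1.
Proof.
by have := commA x y z; rewrite !commVr commVl !invgK invgR => <-.
Qed.

(** Rotation moves [y] to the last place, where the Engel condition applies. *)
Lemma commute_commg3_mid x y z : commute [~ x, y, z] y.
Proof. by rewrite commg3_rot (commg3_rot y) invgK; apply: commute_commgr. Qed.

Lemma commg3_eq1 x y z : [~ x, y, z] = 1.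
Proof.
have HWterm (a b c : G) : [~ a, b^-1, c] ^ b = [~ a, b, c]^-1.
  rewrite commVr commVl.
  apply/conjg_fixP/commgP/commute_sym/commuteV/commute_sym.
  exact: commute_commg3_mid.
have := Hall_Witt _ y z x; rewrite !HWterm.
by rewrite (commg3_rot y) invgK mulgV mul1g => /(canRL invgK); rewrite invg1.
Qed.

End AssociativeStar.

(** * The third term of the lower central series *)

Section LowerCentralThree.
Variable G : groupType.

Lemma commutator_subgroup_id1 (H K : set G) : commutator_subgroup H K 1.
Proof. by move=> M [[M1 _] _]; rewrite -in_setE. Qed.

Lemma mem_commutator_subgroup {H K : set G} x y :
  H x -> K y -> commutator_subgroup H K [~ x, y].
Proof. by move=> Hx Ky; apply: sub_gen_smallest; exists x => //; exists y. Qed.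

Lemma commutator_subgroup_sub {H K M : set G} :
    group_closed [in M] -> (forall x y, H x -> K y -> M [~ x, y]) ->
  commutator_subgroup H K `<=` M.
Proof.
by move=> Mgrp RM; apply: smallest_sub => // _ [x Hx [y Ky <-]]; apply: RM.
Qed.

Lemma group_closed_center :
  group_closed [in [set x : G | forall y, commute x y]].
Proof.
split; first by rewrite !inE => y; apply/commute_sym/commute1.
move=> x y; rewrite !inE => cx cy z.
by apply/commute_sym/commuteM; [|apply: commuteV]; apply: commute_sym.
Qed.

Lemma group_closed_set1 : group_closed [in [set 1 : G]].
Proof. by split=> [|x y]; rewrite !inE // => -> ->; rewrite mulgV. Qed.

(** Triple commutators of elements suffice because the centre is a subgroup:
once it contains all the commutators it contains the derived subgroup. *)
Lemma lower_central3_eq1 :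
  lower_central G 3 = [set 1] <-> forall x y z : G, [~ x, y, z] = 1.
Proof.
split=> [G3 x y z | comm3].
  have : lower_central G 3 [~ x, y, z].
    by apply: mem_commutator_subgroup => //; apply: mem_commutator_subgroup.
  by rewrite G3.
apply/seteqP; split; last by move=> _ ->; apply: commutator_subgroup_id1.
apply: commutator_subgroup_sub group_closed_set1 _ => x y G2x _.
apply/eqP/commgP; move: x G2x y.
apply: commutator_subgroup_sub group_closed_center _ => x y _ _ z.
exact/commgP/eqP/comm3.
Qed.

End LowerCentralThree.

Theorem proposition3p7 (G : groupType) :
  associative (star (almost_trivial G)) <-> lower_central G 3 = [set 1].
Proof.
rewrite lower_central3_eq1; split=> [starA | comm3 x y z].
  exact: commg3_eq1.
rewrite !star_almost_trivialE comm3.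
apply/eqP/commgP/commuteV/commute_sym.
exact/commgP/eqP/comm3.
Qed.
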